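(* There exists a family of functions $f_n:\{0,1\}^n\to\mathbb{R}$ that has polynomial-size arithmetic formulas, but no polynomial-size multilinear formulas. That is, there is a polynomial $q$ such that for every $n$ some arithmetic formula of size at most $q(n)$ computes a polynomial agreeing with $f_n$ on $\{0,1\}^n$, while there is no polynomial $r$ such that $\mathrm{MFS}(f_n)\le r(n)$ for all $n$.
   Context: An arithmetic formula over $\mathbb{C}$ in variables $x_1,\dots,x_n$ is a rooted binary tree whose leaves are labeled with complex numbers or variables and whose non-leaf vertices are labeled $+$ or $\times$; it computes a polynomial in the obvious way. A polynomial is multilinear if no variable appears raised to a power higher than $1$; a formula is multilinear if the polynomial computed by each of its subtrees is multilinear. The size of a formula is its number of leaves. For a multilinear polynomial $p$, $\mathrm{MFS}(p)$ is the minimum size of a multilinear formula computing $p$; for $f:\{0,1\}^n\to\mathbb{C}$, $\mathrm{MFS}(f)$ is the minimum of $\mathrm{MFS}(p)$ over multilinear $p$ with $p(x)=f(x)$ for all $x\in\{0,1\}^n$. *)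

(* Defs.v *)
From HB Require Import structures.
From mathcomp Require Import all_boot all_order all_algebra.
From mathcomp Require Import boolp reals.
From mathcomp Require Export complex.
From mathcomp Require Export mpoly.

Set Implicit Arguments.
Unset Strict Implicit.
Unset Printing Implicit Defensive.

Import GRing.Theory.
Local Open Scope ring_scope.

Inductive formula (K : Type) (n : nat) : Type :=
| Const of K
| Var of 'I_n
| Add of formula K n & formula K n
| Mul of formula K n & formula K n.

Arguments Const {K n}.
Arguments Var {K n}.

Fixpoint fsize (K : Type) (n : nat) (F : formula K n) : nat :=
  match F with
  | Const _ | Var _ => 1
  | Add F1 F2 | Mul F1 F2 => fsize F1 + fsize F2
  end%N.

Fixpoint fpoly (K : comNzRingType) (n : nat) (F : formula K n) : {mpoly K[n]} :=
  match F with
  | Const c => c%:MP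
  | Var i => 'X_i
  | Add F1 F2 => fpoly F1 + fpoly F2
  | Mul F1 F2 => fpoly F1 * fpoly F2
  end.

Definition multilinear (K : nzRingType) (n : nat) (p : {mpoly K[n]}) : bool :=
  all (fun m : 'X_{1..n} => [forall i, (m i <= 1)%N]) (msupp p).

Fixpoint mlformula (K : comNzRingType) (n : nat) (F : formula K n) : bool :=
  multilinear (fpoly F) &&
  match F with
  | Const _ | Var _ => true
  | Add F1 F2 | Mul F1 F2 => mlformula F1 && mlformula F2
  end.

(* The value 0 on the empty predicate is junk: [MFS_polyP] and [MFSP] below
   show that the minima defining MFS range over nonempty sets. *)
Definition nat_min (A : nat -> Prop) : nat :=
  match pselect (exists s, `[< A s >]) with
  | left exA => ex_minn exA
  | right _ => 0
  end.

Definition MFS_poly (K : comNzRingType) (n : nat) (p : {mpoly K[n]}) : nat :=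
  nat_min (fun s => exists F : formula K n,
    [/\ mlformula F, fpoly F = p & fsize F = s]).

Definition agrees_on_cube (K : comNzRingType) (n : nat) (p : {mpoly K[n]})
    (f : {ffun 'I_n -> bool} -> K) : Prop :=
  forall x : {ffun 'I_n -> bool}, p.@[fun i => (x i)%:R] = f x.

Definition MFS (K : comNzRingType) (n : nat)
    (f : {ffun 'I_n -> bool} -> K) : nat :=
  nat_min (fun s => exists p : {mpoly K[n]},
    [/\ multilinear p, agrees_on_cube p f & MFS_poly p = s]).

Lemma nat_minP (A : nat -> Prop) : (exists s, A s) ->
  A (nat_min A) /\ forall s, A s -> (nat_min A <= s)%N.
Proof.
move=> exA; rewrite /nat_min; case: pselect => [exA'|[]]; last first.
  by case: exA => s As; exists s; apply/asboolP.
case: ex_minnP => s /asboolP As s_min; split=> // t At.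
exact/s_min/asboolP.
Qed.

Section Existence.
Variables (K : comNzRingType) (n : nat).
Implicit Types (p : {mpoly K[n]}) (F : formula K n).

Lemma multilinearP p :
  reflect (forall m, m \in msupp p -> forall i, (m i <= 1)%N) (multilinear p).
Proof.
apply: (iffP allP) => [H m /H /forallP //|H m mp].
by apply/forallP; apply: H.
Qed.

Lemma multilinear_sum (I : eqType) (s : seq I) (c : I -> K)
    (e : I -> 'X_{1..n}) :
  (forall j, j \in s -> forall i, (e j i <= 1)%N) ->
  multilinear (\sum_(j <- s) c j *: 'X_[e j]).
Proof.
move=> He; apply/multilinearP => m /msupp_sum_le /flatten_mapP [j].
rewrite filter_predT => js /msuppZ_le; rewrite msuppX inE => /eqP -> i.
exact: He.
Qed.

Lemma multilinearX (m : 'X_{1..n}) :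
  (forall i, (m i <= 1)%N) -> multilinear ('X_[m] : {mpoly K[n]}).
Proof. by move=> Hm; apply/multilinearP=> k; rewrite msuppX inE => /eqP ->. Qed.

Lemma multilinearC (c : K) : multilinear (c%:MP : {mpoly K[n]}).
Proof.
apply/multilinearP => m; rewrite msuppC; case: eqP => // _.
by rewrite inE => /eqP -> i; rewrite mnm0E.
Qed.

Lemma mlformula_monomial (m : 'X_{1..n}) : (forall i, (m i <= 1)%N) ->
  exists F, mlformula F /\ fpoly F = 'X_[m].
Proof.
have [d] := ubnP (mdeg m); elim: d m => // d IHd m lt_m_d Hm.
have [->|m0] := eqVneq m 0%MM.
  by exists (Const 1); rewrite /= multilinearC mpolyX0.
have [i mi] : exists i, m i != 0%N.
  apply/existsP; apply: contra_neqT m0 => /existsPn m0.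
  by apply/mnmP=> i; rewrite mnm0E; have := m0 i; rewrite negbK => /eqP.
have Um : (U_(i) <= m)%MM by rewrite lep1mP.
have Em : (U_(i) + (m - U_(i)))%MM = m by rewrite addmC submK.
have [|j|F [mlF eF]] := IHd (m - U_(i))%MM.
- by move: lt_m_d; rewrite -{1}Em mdegD mdeg1 add1n.
- by rewrite mnmBE (leq_trans (leq_subr _ _)).
exists (Mul (Var i) F) => /=; rewrite eF -mpolyXD Em mlF multilinearX //.
rewrite multilinearX // => j; rewrite mnm1E; exact: leq_b1.
Qed.

Lemma mlformula_exists p : multilinear p ->
  exists F, mlformula F /\ fpoly F = p.
Proof.
move=> /multilinearP; rewrite {2}[p]mpolyE.
elim: (msupp p) => [_|m s IHs Hs].
  by exists (Const 0); rewrite /= multilinearC big_nil mpolyC0.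
have [|F [mlF eF]] := IHs.
  by move=> k ks; apply: Hs; rewrite inE ks orbT.
have Hm : forall i, (m i <= 1)%N by apply: Hs; rewrite mem_head.
have [G [mlG eG]] := mlformula_monomial Hm.
exists (Add (Mul (Const p@_m) G) F).
have := multilinear_sum (fun k => p@_k) Hs.
have := @multilinear_sum _ [:: m] (fun k => p@_k) id.
rewrite big_seq1 big_cons /= eF eG mul_mpolyC mlF mlG multilinearC /= => ->.
  by move=> ->.
by move=> k; rewrite inE => /eqP ->.
Qed.

Lemma multilinear_ext_exists (f : {ffun 'I_n -> bool} -> K) :
  exists p, multilinear p /\ agrees_on_cube p f.
Proof.
pose lit (y : {ffun 'I_n -> bool}) i : {mpoly K[n]} :=
  if y i then 'X_i else 1 - 'X_i.
pose q := \sum_y f y *: \prod_i lit y i.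
pose red (m : 'X_{1..n}) := [multinom minn (m i) 1 | i < n].
exists (\sum_(m <- msupp q) q@_m *: 'X_[red m]); split.
  by apply: multilinear_sum => m _ i; rewrite mnmE geq_minr.
move=> x; transitivity (q.@[fun i => (x i)%:R]).
  rewrite [in RHS](mpolyE q) !raddf_sum /=; apply: eq_bigr => m _.
  rewrite !mevalZ !mevalX; congr (_ * _); apply: eq_bigr => i _.
  rewrite mnmE; case: (m i) => [|k]; first by rewrite min0n.
  by rewrite minnSS minn0; case: (x i); rewrite ?expr1n // !expr0n.
rewrite raddf_sum /= (bigD1 x) //= [X in _ + X]big1 ?addr0 => [|y yx].
  rewrite mevalZ rmorph_prod big1 ?mulr1 //= => i _; rewrite /lit.
  by case xi: (x i); rewrite ?mevalB ?meval1 mevalXU xi // subr0.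
have : exists i, y i != x i.
  apply/existsP; apply: contra_neqT yx => /existsPn H.
  by apply/ffunP=> i; have := H i; rewrite negbK => /eqP.
case=> i yxi; rewrite mevalZ rmorph_prod (bigD1 i) //= /lit.
move: yxi; case: (y i); case xi: (x i) => // _;
  by rewrite ?mevalB ?meval1 mevalXU xi ?subrr mul0r mulr0.
Qed.

Lemma MFS_polyP p : multilinear p ->
  (exists F, [/\ mlformula F, fpoly F = p & fsize F = MFS_poly p]) /\
  forall F, mlformula F -> fpoly F = p -> (MFS_poly p <= fsize F)%N.
Proof.
move=> /mlformula_exists [F0 [mlF0 eF0]].
have [|H Hmin] := @nat_minP (fun s => exists F : formula K n,
    [/\ mlformula F, fpoly F = p & fsize F = s]).
  by exists (fsize F0), F0.
by split=> // F mlF eF; apply: Hmin; exists F.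
Qed.

Lemma MFSP (f : {ffun 'I_n -> bool} -> K) :
  (exists p, [/\ multilinear p, agrees_on_cube p f & MFS_poly p = MFS f]) /\
  forall p, multilinear p -> agrees_on_cube p f -> (MFS f <= MFS_poly p)%N.
Proof.
have [p0 [mlp0 p0f]] := multilinear_ext_exists f.
have [|H Hmin] := @nat_minP (fun s => exists p : {mpoly K[n]},
    [/\ multilinear p, agrees_on_cube p f & MFS_poly p = s]).
  by exists (MFS_poly p0), p0.
by split=> // p mlp pf; apply: Hmin; exists p.
Qed.

End Existence.

(* Main.v *)
(* The function reads its input as Boolean values on vertices together with the
   switches of possible edges, and tests that the two ends of every edge that is
   switched on agree. For every balanced split (A, V \ A) of the vertices the
   switches can be fixed to a perfect matching between A and V \ A; the function
   then becomes an equality test, whose 2^(n/2) x 2^(n/2) communication matrix is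
   the identity. Raz's argument shows that for some split a small multilinear
   formula has smaller rank. Walk down the formula with a set S of vertices, kept
   at sum gates and divided between the factors at product gates (a multilinear
   product has factors in disjoint variables), following the larger part. If on
   every path some S is split unevenly by A, each path loses a factor 2^(d/2) in
   rank. Along one path there are t nested sets with linear gaps, so a uniform
   subset A splits all of them evenly with probability about (d / sqrt n)^t;
   conditioning on |A| = n/2 costs only a factor n + 1, and for t constant but
   large a union bound over the paths finishes the proof. *)
Require Import Defs.
From mathcomp Require Import all_boot all_order all_algebra.
From mathcomp Require Import boolp reals.
From mathcomp Require Import complex mpoly zify.

Set Implicit Arguments.
Unset Strict Implicit.
Unset Printing Implicit Defensive.

Import Order.TTheory GRing.Theory Num.Theory.

(** * Counting balanced sets *)

Lemma leq_card_bigcup (X : finType) (I : Type) (r : seq I) (P : pred I)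
    (B : I -> {set X}) :
  (#|\bigcup_(i <- r | P i) B i| <= \sum_(i <- r | P i) #|B i|)%N.
Proof.
elim/big_rec2: _ => [|i s U _ le_s]; first by rewrite cards0.
by rewrite (leq_trans (leq_card_setU _ _).1) ?leq_add2l.
Qed.

Lemma leq_expn2r a b e : (a <= b -> a ^ e <= b ^ e)%N.
Proof. by case: e => // e; rewrite leq_exp2r. Qed.

Lemma leq_bin_half m j : 'C(m, j) <= 'C(m, m./2).
Proof.
wlog le_j : j / j <= m./2.
  move=> wl; case: (leqP j m./2) => [/wl//|gt_j].
  case: (leqP j m) => [le_jm|gt_jm]; last by rewrite bin_small.
  by rewrite -bin_sub // wl //; lia.
have up i : i < m./2 -> 'C(m, i) <= 'C(m, i.+1).
  move=> lt_i; rewrite -(leq_pmul2l (ltn0Sn i)) mul_bin_left.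
  by rewrite leq_mul2r; apply/orP; right; lia.
rewrite -(subKn le_j); elim: (_ - j) => [|e IH]; first by rewrite subn0.
case: (leqP m./2 e) => [le_e|lt_e]; first by rewrite (_ : _ - _ = m./2 - e) //; lia.
apply: leq_trans IH.
have -> : m./2 - e = (m./2 - e.+1).+1 by lia.
by apply: up; lia.
Qed.

(** Squaring avoids square roots. Passing from h to h + 1 multiplies the binomial by 2(2h + 1)/(h +
    1), so the induction rests on (2h + 1)(2h + 3) <= 4(h + 1)^2. *)
Lemma central_bin_sqr h : 'C(h.*2, h) ^ 2 * h.*2.+1 <= 16 ^ h.
Proof.
elim: h => [|h IH]; first by [].
have E : h.+1 * 'C(h.+1.*2, h.+1) = 2 * h.*2.+1 * 'C(h.*2, h).
  have E1 := mul_bin_diag h.*2.+2 h; have E2 := mul_bin_down h.*2.+1 h.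
  rewrite doubleS -E1 [h.*2.+2.-1]/= -mulnA; rewrite /= in E2.
  rewrite (_ : h.*2.+2 = 2 * h.+1) ?E2; last by lia.
  by rewrite mulnA; congr (_ * _ * _); lia.
rewrite -(@leq_pmul2l (h.+1 ^ 2)) // mulnA -expnMn E.
rewrite expnMn -(mulnA _ (_ ^ 2)) (expnSr 16).
move: IH; set c := 'C(_, _); set p := 16 ^ h; nia.
Qed.

Lemma bin_sqr m j : 'C(m, j) ^ 2 * m.+1 <= 4 ^ m.
Proof.
have -> : 4 ^ m = (2 ^ m) ^ 2 by rewrite -expnM mulnC expnM.
apply: leq_trans (_ : 'C(m, m./2) ^ 2 * m.+1 <= _).
  by rewrite leq_mul2r leq_sqr leq_bin_half orbT.
rewrite -expnM; have := odd_double_half m; move: m./2 => h.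
case: (odd m) => /= <-; last first.
  rewrite add0n; apply: leq_trans (central_bin_sqr h) _.
  by rewrite -[16]/(2 ^ 4) -expnM leq_exp2l //; lia.
rewrite add1n; have := central_bin_sqr h.+1.
have -> : 'C(h.+1.*2, h.+1) = 2 * 'C(h.*2.+1, h).
  rewrite doubleS binS -(bin_sub (n := h.*2.+1)); last by lia.
  by rewrite (_ : _ - _ = h); lia.
have -> : 2 ^ (h.*2.+1 * 2) = 4 * 16 ^ h.
  by rewrite -[16]/(2 ^ 4) -[4]/(2 ^ 2) -!expnM -expnD; congr (_ ^ _); lia.
rewrite expnMn (expnS 16); move: 'C(_, _) (16 ^ h) => c p; rewrite -!mulnn; nia.
Qed.

Lemma exp2_leq_bin n : (2 ^ n <= n.+1 * 'C(n, n./2))%N.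
Proof.
rewrite -[X in (X ^ n)%N]/(1 + 1)%N expnDn.
apply: leq_trans (_ : \sum_(i < n.+1) 'C(n, n./2) <= _)%N.
  by rewrite leq_sum // => i _; rewrite !exp1n !muln1 leq_bin_half.
by rewrite sum_nat_const card_ord.
Qed.

Definition balanced (X : finType) d (A T : {set X}) : bool :=
  (#|T :&: A| < #|T :\: A| + d) && (#|T :\: A| < #|T :&: A| + d).

(* At most [2 * d] cardinalities are allowed, each realised at most
   [2 ^ #|D| / sqrt (#|D| + 1)] times. *)
Lemma card_balanced (X : finType) d (D : {set X}) :
  #|[set B in powerset D | balanced (2 * d) B D]| ^ 2 * #|D|.+1
    <= (2 * d) ^ 2 * 4 ^ #|D|.
Proof.
set h := #|D|./2; set b := 'C(#|D|, h).
suff le_b : #|[set B in powerset D | balanced (2 * d) B D]| <= 2 * d * b.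
  apply: leq_trans (_ : (2 * d * b) ^ 2 * #|D|.+1 <= _).
    by rewrite leq_mul2r leq_sqr le_b orbT.
  by rewrite expnMn -mulnA leq_mul2l bin_sqr orbT.
pose draw (i : 'I_(2 * d)) :=
  [set B : {set X} | (B \subset D) && (#|B| == h.+1 + i - d)].
apply: leq_trans (_ : #|\bigcup_i draw i| <= _).
  apply/subset_leq_card/subsetP => B; rewrite !inE /balanced => /andP[BD].
  have := cardsID B D; rewrite (setIidPr BD) => cD /andP[lt1 lt2].
  have ltd : #|B| + d - h.+1 < 2 * d by rewrite /h; lia.
  apply/bigcupP; exists (Ordinal ltd); rewrite ?inE ?BD //=.
  by apply/eqP; rewrite /h in ltd *; lia.
apply: leq_trans (leq_card_bigcup _ _ _) _.
rewrite -{5}(card_ord (2 * d)) -sum_nat_const leq_sum // => i _.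
by rewrite cards_draws leq_bin_half.
Qed.

Definition half_step (X : finType) (S T : {set X}) :=
  (T \subset S) && (#|S| <= 2 * #|T|).

Lemma path_subset (X : finType) (S : {set X}) s : path (@half_step X) S s ->
  {in s, forall T : {set X}, T \subset S}.
Proof.
move=> ps T Ts; pose e (U V : {set X}) := V \subset U.
have /sub_path/(_ _ _ ps) : subrel (@half_step X) e by move=> U V /andP[].
move/order_path_min => /(_ _)/allP; apply=> // U V W VU UW.
exact: subset_trans UW VU.
Qed.

Lemma balanced_setI (X : finType) d (A T U : {set X}) : U \subset T ->
  balanced d (A :&: T) U = balanced d A U.
Proof.
move=> UT; rewrite /balanced (_ : U :&: (A :&: T) = U :&: A).
  by rewrite setDIr (eqP (_ : U :\: T == set0)) ?setU0 // setD_eq0.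
by rewrite setICA (setIidPl UT) setIC.
Qed.

(** The signed imbalance of [T :\: U] is that of [T] minus that of [U], so the tolerances add. *)
Lemma balanced_setD (X : finType) d (A T U : {set X}) : U \subset T ->
  balanced d A T -> balanced d A U -> balanced (2 * d) (A :\: U) (T :\: U).
Proof.
move=> UT; rewrite /balanced.
have := cardsID U (T :&: A); have := cardsID U (T :\: A).
have -> : T :&: A :&: U = U :&: A by rewrite setIAC (setIidPr UT).
have -> : (T :\: A) :&: U = U :\: A by rewrite setIDAC (setIidPr UT).
have -> : (T :\: U) :&: (A :\: U) = (T :&: A) :\: U.
  by apply/setP => i; rewrite !inE; case: (i \in U); rewrite ?andbF.
have -> : (T :\: U) :\: (A :\: U) = (T :\: A) :\: U.
  by apply/setP => i; rewrite !inE; case: (i \in U); rewrite ?andbF.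
move: #|T :&: A| #|T :\: A| #|U :&: A| #|U :\: A|.
by move: #|_ :\: _| #|_ :\: _|; lia.
Qed.

Definition balanced_sets (X : finType) d (T : {set X}) s :=
  [set A in powerset T | balanced d A T && all (balanced d A) s].

(** [A] is determined by [A :&: U], which meets the constraints of the shorter chain, and [A :\: U],
    which splits the gap [T :\: U] evenly up to the doubled tolerance. *)
Lemma card_balanced_sets_cons (X : finType) d (T U : {set X}) s : U \subset T ->
    {in s, forall V : {set X}, V \subset U} ->
  #|balanced_sets d T (U :: s)| <= #|balanced_sets d U s| *
    #|[set B in powerset (T :\: U) | balanced (2 * d) B (T :\: U)]|.
Proof.
move=> UT sU; rewrite -cardsX.
rewrite -(card_in_imset (f := fun A => (A :&: U, A :\: U))); last first.
  by move=> A B _ _ [eI eD]; rewrite -(setID A U) eI eD setID.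
apply/subset_leq_card/subsetP => _ /imsetP[A + ->].
rewrite !inE /= => /and4P[AT balT balU bals].
rewrite subsetIr balanced_setI // balU setSD // balanced_setD // !andbT /=.
by apply/allP => V Vs; rewrite balanced_setI ?sU // (allP bals).
Qed.

(** [S] runs down the chain while [T] stays at the last selected set; [S'] is selected once it has
    at most half the size of [T]. As each step at most halves, [S'] then keeps more than a quarter
    of [T], so [t] selections fit above [tau]. Each gap [T :\: S'] has at least [tau] elements and
    saves a factor (2d)^2 / tau in the squared count. *)
Lemma card_balanced_sets (X : finType) d tau (S T : {set X}) s t :
    path (@half_step X) S s -> #|last S s| < tau ->
    S \subset T -> #|T| < 2 * #|S| -> 4 ^ t * tau <= #|T| ->
  #|balanced_sets d T s| ^ 2 * tau ^ t <= (2 * d) ^ (2 * t) * 4 ^ #|T|.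
Proof.
have card0 (U : {set X}) r :
    #|balanced_sets d U r| ^ 2 * tau ^ 0 <= (2 * d) ^ (2 * 0) * 4 ^ #|U|.
  rewrite muln1 mul1n -[4]/(2 ^ 2) -expnM mulnC expnM leq_sqr.
  rewrite -card_powerset subset_leq_card //.
  by apply/subsetP => A; rewrite inE => /andP[].
have le_pow e : tau <= 4 ^ e * tau by rewrite leq_pmull // expn_gt0.
elim: s t S T => [|S' s IH] t S T.
  case: t => [|t] _ /= lt_tau _ lt_T le_T; first exact: card0.
  by have := le_pow t; rewrite expnS in le_T; lia.
move=> /= /andP[/andP[S'S le_S] ps] lt_tau ST lt_T.
case: t => [|t] le_T; first exact: card0.
have S'T := subset_trans S'S ST.
case: (leqP (2 * #|S'|) #|T|) => [le_S'|lt_S']; last first.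
  (* [S'] is still too large: keep [T] and drop the constraint at [S']. *)
  apply: leq_trans (IH _ _ _ ps lt_tau S'T lt_S' le_T).
  rewrite leq_mul2r leq_sqr subset_leq_card ?orbT //.
  by apply/subsetP => A; rewrite !inE /= => /and4P[-> -> _ ->].
have gt_S' : 4 ^ t * tau <= #|S'| by rewrite expnS in le_T; lia.
have S'_gt0 : #|S'| < 2 * #|S'| by lia.
have IHS' := IH t _ _ ps lt_tau (subxx _) S'_gt0 gt_S'.
have cD : #|T| = #|S'| + #|T :\: S'| by rewrite -(cardsID S' T) (setIidPr S'T).
have le_tau : tau <= #|T :\: S'|.+1 by have := le_pow t; lia.
have := card_balanced_sets_cons d S'T (path_subset ps).
rewrite -leq_sqr expnMn => le_c.
apply: leq_trans (_ : #|balanced_sets d S' s| ^ 2 * tau ^ t *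
   (#|[set B in powerset (T :\: S') | balanced (2 * d) B (T :\: S')]| ^ 2 *
     #|T :\: S'|.+1) <= _).
  by rewrite mulnACA leq_mul // expnSr leq_mul2l le_tau orbT.
apply: leq_trans (leq_mul IHS' (card_balanced _ _)) _.
by rewrite cD mulnACA -!expnD mulnSr.
Qed.

(** * Variables, evaluation and rank *)

Local Open Scope ring_scope.
Local Open Scope complex_scope.

Section Dependence.
Variables (K : idomainType) (N : nat).
Implicit Types (p q : {mpoly K[N]}) (i j : 'I_N).

(** The other variables go into the coefficients, so that the degree in one variable is read off
    from a size and adds up in products. *)
Definition univ i p : {poly {mpoly K[N]}} :=
  mmap (polyC \o @mpolyC N K) (fun j => if j == i then 'X else ('X_j)%:P) p.

Lemma univM i : {morph univ i : p q / p * q}.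
Proof. exact: rmorphM. Qed.

Lemma map_univ i p (v : 'I_N -> K) c :
  (map_poly (meval v) (univ i p)).[c] =
  p.@[fun j => if j == i then c else v j].
Proof.
rewrite /univ [in RHS]mevalE /mmap rmorph_sum horner_sum.
apply: eq_bigr => m _; rewrite /= rmorphM hornerM /= map_polyC /= hornerC mevalC.
congr (_ * _); rewrite /mmap1 rmorph_prod horner_prod; apply: eq_bigr => j _.
rewrite rmorphXn horner_exp /=; case: eqP => [->|_]; first by rewrite map_polyX hornerX.
by rewrite map_polyC hornerC /= mevalXU.
Qed.

Lemma horner_univ i p : (univ i p).['X_i] = p.
Proof.
rewrite [RHS]mpolyE /univ /mmap horner_sum.
have E m : ((polyC \o mpolyC N (R:=K)) p@_m *
      mmap1 (fun j => if j == i then 'X else ('X_j)%:P) m).['X_i] = p@_m *: 'X_[m].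
  rewrite hornerM /= hornerC mul_mpolyC /mmap1 horner_prod.
  rewrite -[in RHS]mmap1_id /mmap1; congr (_ *: _); apply: eq_bigr => j _.
  by rewrite horner_exp; case: eqP => [->|_]; rewrite ?hornerX ?hornerC.
by elim: (msupp p) => [|m s IH]; rewrite ?big_nil // !big_cons IH E.
Qed.

Lemma univ_eq0 i p : (univ i p == 0) = (p == 0).
Proof.
apply/eqP/eqP => [up|->]; last by rewrite /univ mmap0.
by rewrite -(horner_univ i p) up horner0.
Qed.

Lemma size_univ i p : multilinear p -> (size (univ i p) <= 2)%N.
Proof.
move=> /multilinearP mlp; apply: leq_trans (size_sum _ _ _) _.
apply/bigmax_leqP_seq => m mp _.
rewrite /mmap1 (bigD1 i) //= eqxx.
rewrite [X in _ * (_ * X)](_ : _ = (\prod_(j < N | j != i) 'X_j ^+ m j)%:P).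
  rewrite mulrCA mulrC -polyCM mul_polyC (leq_trans (size_scale_leq _ _)) //.
  by rewrite size_polyXn; apply: mlp.
rewrite rmorph_prod; apply: eq_bigr => j /negPf ->.
by rewrite rmorphXn.
Qed.

Definition vars p := [set i | (1 < size (univ i p))%N].

Lemma in_varsE p i : (i \in vars p) = (1 < size (univ i p))%N.
Proof. by rewrite in_set. Qed.

(** Over an integral domain a variable of positive degree in both factors would have degree at least
    2 in the product. *)
Lemma disjoint_vars p q : p * q != 0 -> multilinear (p * q) ->
  [disjoint vars p & vars q].
Proof.
have no_gap k l : (1 < k -> 1 < l -> ~~ ((k + l).-1 <= 2))%N by lia.
rewrite mulf_eq0 negb_or => /andP[p0 q0] mlpq.
rewrite disjoint_subset; apply/subsetP => i; rewrite in_varsE => ip.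
rewrite inE /= in_varsE; apply/negP => iq.
have := no_gap _ _ ip iq; rewrite -size_mul ?univ_eq0 //.
by rewrite -univM size_univ.
Qed.

Definition ev p (x : {ffun 'I_N -> bool}) : K := p.@[fun i => (x i)%:R].

Lemma eq_ev p (x y : {ffun 'I_N -> bool}) :
  {in vars p, x =1 y} -> ev p x = ev p y.
Proof.
have [d] := ubnP #|[set i | x i != y i]|; elim: d x => // d IHd x le_d eq_xy.
have [xy0|[i ]] := set_0Vmem [set i | x i != y i].
  congr ev; apply/ffunP => i; apply/eqP.
  by move/setP/(_ i): xy0; rewrite !inE => /negbFE.
rewrite inE => xyi.
have ip : (size (univ i p) <= 1)%N.
  by rewrite leqNgt; apply: contraNN xyi => ip; rewrite eq_xy ?in_varsE.
pose z := [ffun j => if j == i then y j else x j].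
have -> : ev p x = ev p z.
  pose v j : K := (x j)%:R.
  transitivity (map_poly (meval v) (univ i p)).[v i].
    by rewrite map_univ; apply: meval_eq => j; case: eqP => // ->.
  transitivity (map_poly (meval v) (univ i p)).[(y i)%:R].
    by rewrite (size1_polyC ip) map_polyC !hornerC.
  by rewrite map_univ; apply: meval_eq => j; rewrite ffunE; case: eqP => // ->.
apply: IHd => [|j jp]; last by rewrite ffunE eq_xy ?if_same.
rewrite -ltnS (leq_trans _ le_d) // ltnS; apply: proper_card; apply/properP; split.
  by apply/subsetP => j; rewrite !inE ffunE; case: (j == i) => //; rewrite eqxx.
by exists i; rewrite !inE ?ffunE ?eqxx.
Qed.

End Dependence.

Section SeparableRank.
Variable K : comNzRingType.

(* [M], seen as a matrix with possibly infinite index types, has rank at most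
   [r]. *)
Definition sep_rank (T U : Type) r (M : T -> U -> K) : Prop :=
  exists (I : finType) (g : I -> T -> K) (h : I -> U -> K),
    (#|I| <= r)%N /\ forall a b, M a b = \sum_l g l a * h l b.

Variables T U : Type.
Implicit Types M : T -> U -> K.

Lemma sep_rank0 M : (forall a b, M a b = 0) -> sep_rank 0 M.
Proof.
move=> M0; exists void, (fun _ _ => 0), (fun _ _ => 0).
by split=> [|a b]; rewrite ?card_void // M0 big1 // => i; case: i.
Qed.

Lemma sep_rank1 M g h : (forall a b, M a b = g a * h b) -> sep_rank 1 M.
Proof.
move=> Mgh; exists unit, (fun=> g), (fun=> h); split=> [|a b].
  by rewrite card_unit.
by rewrite Mgh (big_pred1 tt) //; case.
Qed.

Lemma sep_rankD r1 r2 M M1 M2 : (forall a b, M a b = M1 a b + M2 a b) ->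
  sep_rank r1 M1 -> sep_rank r2 M2 -> sep_rank (r1 + r2) M.
Proof.
move=> MD [I1 [g1 [h1 [le1 M1E]]]] [I2 [g2 [h2 [le2 M2E]]]].
exists (I1 + I2)%type, (fun l => match l with inl l => g1 l | inr l => g2 l end),
  (fun l => match l with inl l => h1 l | inr l => h2 l end).
by split=> [|a b]; rewrite ?card_sum ?leq_add // MD M1E M2E big_sumType.
Qed.

Lemma sep_rankM r1 r2 M M1 M2 : (forall a b, M a b = M1 a b * M2 a b) ->
  sep_rank r1 M1 -> sep_rank r2 M2 -> sep_rank (r1 * r2) M.
Proof.
move=> MM [I1 [g1 [h1 [le1 M1E]]]] [I2 [g2 [h2 [le2 M2E]]]].
exists (I1 * I2)%type, (fun l a => g1 l.1 a * g2 l.2 a),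
  (fun l b => h1 l.1 b * h2 l.2 b).
split=> [|a b]; first by rewrite card_prod leq_mul.
rewrite MM M1E M2E big_distrlr /= pair_bigA /=.
by apply: eq_bigr => l _; rewrite mulrACA.
Qed.

End SeparableRank.

Lemma sep_rank_tr (K : comNzRingType) (T U : Type) r (M : T -> U -> K) :
  sep_rank r (fun b a => M a b) -> sep_rank r M.
Proof.
case=> I [g [h [le_r ME]]]; exists I, h, g; split=> // a b; rewrite ME.
by apply: eq_bigr => l _; rewrite mulrC.
Qed.

Lemma sep_rank_support (K : comNzRingType) (X : finType) (U : Type)
    (B : {set X}) (M : {set X} -> U -> K) :
  (forall a b, M a b = M (a :&: B) b) -> sep_rank (2 ^ #|B|) M.
Proof.
move=> MB; exists {c | c \in powerset B}, (fun c a => (a :&: B == val c)%:R),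
  (fun c b => M (val c) b); split=> [|a b].
  by rewrite card_sig -card_powerset; apply/eq_leq/eq_card.
have aB : a :&: B \in powerset B by rewrite powersetE subsetIr.
pose c0 : {c | c \in powerset B} := exist _ (a :&: B) aB.
rewrite (bigD1 c0) //= eqxx mul1r -MB big1 ?addr0 // => c.
by rewrite -val_eqE /= eq_sym => /negPf ->; rewrite mul0r.
Qed.

Lemma sep_rank_id (F : fieldType) (T U : Type) r m (M : T -> U -> F)
    (e : 'I_m -> T) (e' : 'I_m -> U) :
  (forall i j, M (e i) (e' j) = (i == j)%:R) -> sep_rank r M -> (m <= r)%N.
Proof.
move=> Mid [I [g [h [le_r ME]]]]; apply: leq_trans le_r.
rewrite -(mxrank1 F m).
pose G := \matrix_(i < m, l < #|I|) g (enum_val l) (e i).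
pose H := \matrix_(l < #|I|, j < m) h (enum_val l) (e' j).
suff -> : 1%:M = G *m H by exact: mulmx_max_rank.
apply/matrixP => i j; rewrite !mxE -Mid ME.
rewrite (reindex_onto enum_val enum_rank) /= => [|l _]; last exact: enum_rankK.
rewrite (eq_bigl predT) => [|l]; last by rewrite enum_valK eqxx.
by apply: eq_bigr => l _; rewrite !mxE.
Qed.

(** * The rank of a multilinear formula *)

Section Chains.
Variables (K : idomainType) (N : nat).
Implicit Types (F : formula K N) (A S T a b : {set 'I_N}) (tau d : nat).

(* The chains of variable sets met on the way down from [F], where a product
   gate splits [S] in two and only the larger part is followed. A leaf reached
   while [S] is still large contributes nothing, as its matrix has rank 1. *)
Fixpoint chains tau F S : seq (seq {set 'I_N}) :=
  if (#|S| < tau)%N then [:: [:: S]] else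
  match F with
  | Const _ | Var _ => [::]
  | Add F1 F2 => chains tau F1 S ++ chains tau F2 S
  | Mul F1 F2 =>
    let V := vars (fpoly F1) in
    if (#|S :\: V| <= #|S :&: V|)%N
    then map (cons S) (chains tau F1 (S :&: V))
    else map (cons S) (chains tau F2 (S :\: V))
  end.

Lemma fsize_gt0 F : (0 < fsize F)%N.
Proof. by elim: F => //= F1 IH1 F2 IH2; rewrite addn_gt0 IH1. Qed.

Lemma size_chains tau F S : (size (chains tau F S) <= fsize F)%N.
Proof.
elim: F S => [c|i|F1 IH1 F2 IH2|F1 IH1 F2 IH2] S /=; case: ifP => //= _.
- by rewrite addn_gt0 fsize_gt0.
- by rewrite size_cat leq_add.
- by rewrite addn_gt0 fsize_gt0.
case: ifP => _; rewrite size_map.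
  exact: leq_trans (IH1 _) (leq_addr _ _).
exact: leq_trans (IH2 _) (leq_addl _ _).
Qed.

Lemma chainsP tau F S c : c \in chains tau F S ->
  exists s, [/\ c = S :: s, path (@half_step 'I_N) S s & (#|last S s| < tau)%N].
Proof.
elim: F S c => [x|i|F1 IH1 F2 IH2|F1 IH1 F2 IH2] S c /=; case: ifP => // ltS;
  try by rewrite inE => /eqP ->; exists [::].
  by rewrite mem_cat => /orP[/IH1|/IH2].
have cardS := cardsID (vars (fpoly F1)) S.
case: ifP => le_half /mapP[c' cc' ->].
  have [s [-> ps lt_tau]] := IH1 _ _ cc'.
  exists (S :&: vars (fpoly F1) :: s); split=> //=; rewrite ps /half_step.
  by rewrite subsetIl andbT /= -cardS mul2n -addnn leq_add2l.
have [s [-> ps lt_tau]] := IH2 _ _ cc'.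
exists (S :\: vars (fpoly F1) :: s); split=> //=; rewrite ps /half_step.
rewrite subsetDl andbT /= -cardS mul2n -addnn leq_add2r ltnW //.
by rewrite ltnNge le_half.
Qed.

(** Rows of the matrix are choices on [S :&: A], columns are choices on [S :\: A], and [w] fixes all
    variables outside [S]. *)
Definition assign (w A S a b : {set 'I_N}) : {ffun 'I_N -> bool} :=
  [ffun i => if i \in S then if i \in A then i \in a else i \in b else i \in w].

Definition ev_mx w A S (p : {mpoly K[N]}) a b : K := ev p (assign w A S a b).

(** The rank is at most 2 to the size of the smaller side, and the other side is larger by at least
    [d]. *)
Lemma unbalanced_rank w A S d p : ~~ balanced d A S ->
  exists r, sep_rank r (ev_mx w A S p) /\ (r ^ 2 * 2 ^ d <= 2 ^ #|S|)%N.
Proof.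
rewrite negb_and -!leqNgt -(cardsID A S) => /orP[le_d|le_d].
  exists (2 ^ #|S :\: A|)%N; split; last first.
    by rewrite -expnM -expnD leq_exp2l //; lia.
  apply/sep_rank_tr/sep_rank_support => b a; congr ev; apply/ffunP => i.
  by rewrite !ffunE !inE; case: (i \in S) (i \in A) => [] []; rewrite ?andbT.
exists (2 ^ #|S :&: A|)%N; split; last first.
  by rewrite -expnM -expnD leq_exp2l //; lia.
apply: sep_rank_support => a b; congr ev; apply/ffunP => i.
by rewrite !ffunE !inE; case: (i \in S) (i \in A) => [] []; rewrite ?andbT.
Qed.

(** The factors have disjoint variables, so each one needs only its own part of [S]; the rest may be
    set from [w]. *)
Lemma ev_mxM w A S p q a b : p * q != 0 -> multilinear (p * q) ->
  ev_mx w A S (p * q) a b =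
  ev_mx w A (S :&: vars p) p a b * ev_mx w A (S :\: vars p) q a b.
Proof.
move=> pq0 mlpq; rewrite /ev_mx [LHS]mevalM -!/(ev _ _); congr (_ * _).
  by apply: eq_ev => i ip; rewrite !ffunE inE ip andbT.
have := disjoint_vars pq0 mlpq; rewrite disjoint_sym => /disjointFr dpq.
by apply: eq_ev => i iq; rewrite !ffunE inE dpq.
Qed.

(** The cross term of the square is bounded by multiplying the two hypotheses. *)
Lemma rank_addn (r1 r2 s1 s2 d m : nat) :
  (r1 ^ 2 * 2 ^ d <= s1 ^ 2 * 2 ^ m -> r2 ^ 2 * 2 ^ d <= s2 ^ 2 * 2 ^ m ->
   (r1 + r2) ^ 2 * 2 ^ d <= (s1 + s2) ^ 2 * 2 ^ m)%N.
Proof.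
set x := (2 ^ d)%N; set y := (2 ^ m)%N => le1 le2.
have cross : (r1 * r2 * x <= s1 * s2 * y)%N.
  rewrite -leq_sqr; have := leq_mul le1 le2.
  by rewrite -!mulnn; lia.
by rewrite -!mulnn in le1 le2 *; lia.
Qed.

(** In effect r <= size * 2^((|S| - d)/2). At a sum, ranks and sizes add; at a product the followed
    factor carries the saving, and the other contributes at most 2 to half the size of its part of
    [S]. *)
Lemma ev_mx_rank w A S tau d F : mlformula F -> (d <= tau)%N ->
  (forall c, c \in chains tau F S -> ~~ all (balanced d A) c) ->
  exists r, sep_rank r (ev_mx w A S (fpoly F)) /\
    (r ^ 2 * 2 ^ d <= fsize F ^ 2 * 2 ^ #|S|)%N.
Proof.
move=> mlF le_d; elim: F S mlF => [x|i|F1 IH1 F2 IH2|F1 IH1 F2 IH2] S.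
- move=> _ /=; case: ltnP => [_ /(_ [:: S])|leS _].
    rewrite mem_head /= andbT => /(_ isT)/(unbalanced_rank w x%:MP).
    by rewrite mul1n.
  exists 1%N; rewrite !mul1n leq_exp2l // (leq_trans le_d) //; split=> //.
  by apply: (@sep_rank1 _ _ _ _ (fun=> x) (fun=> 1)) => a b; rewrite mulr1 [LHS]mevalC.
- move=> _ /=; case: ltnP => [_ /(_ [:: S])|leS _].
    rewrite mem_head /= andbT => /(_ isT)/(unbalanced_rank w 'X_i).
    by rewrite mul1n.
  exists 1%N; rewrite !mul1n leq_exp2l // (leq_trans le_d) //; split=> //.
  pose h (c : {set 'I_N}) : K := (assign w A S c c i)%:R.
  have [iA|iA] := boolP (i \in A).
    apply: (@sep_rank1 _ _ _ _ h (fun=> 1)) => a b.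
    by rewrite mulr1 [LHS]mevalXU /h !ffunE iA.
  apply: (@sep_rank1 _ _ _ _ (fun=> 1) h) => a b.
  by rewrite mul1r [LHS]mevalXU /h !ffunE (negPf iA).
- move=> /= /and3P[_ ml1 ml2]; case: ltnP => [_ /(_ [:: S])|leS unb].
    rewrite mem_head /= andbT => /(_ isT)/(unbalanced_rank w (fpoly F1 + fpoly F2)).
    case=> r [rk le_r]; exists r; split=> //; apply: leq_trans le_r _.
    by rewrite leq_pmull // expn_gt0 addn_gt0 fsize_gt0.
  have [|r1 [rk1 le1]] := IH1 S ml1.
    by move=> c cc; apply: unb; rewrite mem_cat cc.
  have [|r2 [rk2 le2]] := IH2 S ml2.
    by move=> c cc; apply: unb; rewrite mem_cat cc orbT.
  exists (r1 + r2)%N; split; last exact: rank_addn.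
  by apply: sep_rankD rk1 rk2 => a b; rewrite [LHS]mevalD.
move=> mlF; have /= /and3P[mlM ml1 ml2] := mlF.
set V := vars _; case: ltnP => [_ /(_ [:: S])|leS unb].
  rewrite mem_head /= andbT => /(_ isT)/(unbalanced_rank w (fpoly F1 * fpoly F2)).
  case=> r [rk le_r]; exists r; split=> //; apply: leq_trans le_r _.
  by rewrite leq_pmull // expn_gt0 addn_gt0 fsize_gt0.
have [balS|] := boolP (balanced d A S); last first.
  move=> /(unbalanced_rank w (fpoly F1 * fpoly F2)).
  case=> r [rk le_r]; exists r; split=> //; apply: leq_trans le_r _.
  by rewrite leq_pmull // expn_gt0 addn_gt0 fsize_gt0.
have [FM0|FM0] := eqVneq (fpoly F1 * fpoly F2) 0.
  by exists 0%N; split=> //; apply: sep_rank0 => a b; rewrite FM0 [LHS]meval0.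
(* No set is balanced with tolerance 0, so every matrix has rank at most 2^(|T|/2). *)
have free T p : exists r, sep_rank r (ev_mx w A T p) /\ (r ^ 2 <= 2 ^ #|T|)%N.
  have [|r [rk]] := @unbalanced_rank w A T 0 p.
    by rewrite /balanced; lia.
  by rewrite muln1; exists r.
have evM := ev_mxM w A S _ _ FM0 mlM.
case: ifP unb => [_|_] unb.
  have [|r1 [rk1 le1]] := IH1 (S :&: V) ml1.
    by move=> c cc; have := unb _ (map_f (cons S) cc); rewrite /= balS.
  have [r2 [rk2 le2]] := free (S :\: V) (fpoly F2).
  exists (r1 * r2)%N; split; first exact: sep_rankM rk1 rk2.
  rewrite expnMn mulnAC (leq_trans (leq_mul le1 le2)) // -mulnA -expnD cardsID.
  by rewrite leq_mul // leq_sqr leq_addr.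
have [|r2 [rk2 le2]] := IH2 (S :\: V) ml2.
  by move=> c cc; have := unb _ (map_f (cons S) cc); rewrite /= balS.
have [r1 [rk1 le1]] := free (S :&: V) (fpoly F1).
exists (r1 * r2)%N; split; first exact: sep_rankM rk1 rk2.
rewrite expnMn -mulnA (leq_trans (leq_mul le1 le2)) // mulnCA -expnD cardsID.
by rewrite leq_mul // leq_sqr leq_addl.
Qed.

End Chains.

(** Otherwise the halves of [V], at least 2^|V| / (|V| + 1) many, are covered by the sets balanced
    along some chain. There are at most [fsize F] chains, and the count for each contradicts the
    last hypothesis. *)
Lemma ex_unbalanced (K : idomainType) N (F : formula K N) (V : {set 'I_N})
    tau d t : (4 ^ t * tau <= #|V|)%N -> (0 < #|V|)%N ->
    (#|V|.+1 ^ 2 * fsize F ^ 2 * (2 * d) ^ (2 * t) < tau ^ t)%N ->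
  exists A : {set 'I_N}, [/\ A \subset V, #|A| = #|V|./2 &
    forall c, c \in chains tau F V -> ~~ all (balanced d A) c].
Proof.
move=> le_V V_gt0 lt_tau; apply: contrapT => noA.
pose good c := [set A in powerset V | all (balanced d A) c].
pose halves := [set A : {set 'I_N} | (A \subset V) && (#|A| == #|V|./2)].
pose m := (\max_(c <- chains tau F V) #|good c|)%N.
have halves_good : halves \subset \bigcup_(c <- chains tau F V) good c.
  apply/subsetP => A; rewrite inE => /andP[AV /eqP cA].
  have [|/hasPn H] := boolP (has (all (balanced d A)) (chains tau F V)); last first.
    by case: noA; exists A.
  elim: (chains _ _ _) => //= c cs IH /orP[Ac|/IH Acs]; rewrite big_cons inE.
    by rewrite inE powersetE AV Ac.
  by rewrite Acs orbT.
have le_m : (m ^ 2 * tau ^ t <= (2 * d) ^ (2 * t) * 4 ^ #|V|)%N.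
  rewrite /m big_seq_cond; elim/big_ind: _ => [|x y Px Py|c]; first by [].
    by rewrite /maxn; case: ifP.
  rewrite andbT => /chainsP[s [-> ps lt_last]].
  apply: leq_trans (card_balanced_sets d ps lt_last (subxx _) _ le_V); last by lia.
  by rewrite leq_mul2r leq_sqr subset_leq_card ?orbT.
have le_halves : ('C(#|V|, #|V|./2) <= fsize F * m)%N.
  rewrite -cards_draws (leq_trans (subset_leq_card halves_good)) //.
  apply: leq_trans (leq_card_bigcup _ _ _) _.
  apply: leq_trans (_ : \sum_(c <- chains tau F V) m <= _)%N.
    rewrite big_seq [leqRHS]big_seq leq_sum // => c cc.
    by rewrite /m (leq_bigmax_seq (F := fun c => #|good c|)).
  by rewrite big_const_seq count_predT iter_addn_0 mulnC leq_mul2r size_chains orbT.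
have := leq_trans (exp2_leq_bin #|V|) (leq_mul (leqnn #|V|.+1) le_halves).
rewrite -leq_sqr -expnM mulnC expnM -[(2 ^ 2)%N]/4%N !expnMn mulnA.
rewrite -(leq_pmul2r (m := tau ^ t)%N); last by lia.
rewrite -(mulnA _ (m ^ 2)%N) leqNgt => /negP; apply.
apply: leq_ltn_trans (leq_mul (leqnn _) le_m) _.
by rewrite mulnA mulnC ltn_pmul2l ?expn_gt0.
Qed.

(** * The hard function *)

(* The edge from [u] to [v] is switched by variable number [(u + v) ^ 2 + u].
   This numbering is injective, and no edge between vertices is switched by a
   vertex, so the switches can be fixed independently of the vertices. *)
Definition edge_ok N (x : {ffun 'I_N -> bool}) (e : 'I_N * 'I_N * 'I_N) : bool :=
  let: (u, v, c) := e in
  (nat_of_ord c == (u + v) ^ 2 + u)%N ==> x c ==> (x u == x v).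

Definition edge_test N (x : {ffun 'I_N -> bool}) : bool :=
  [forall e, edge_ok x e].

Definition vertices n N := [set i : 'I_N | (n <= i < 2 * n)%N].

Lemma card_vertices n N : (2 * n <= N)%N -> #|vertices n N| = n.
Proof.
move=> le_N; have lt (i : 'I_n) : (n + i < N)%N by have := ltn_ord i; lia.
rewrite -[RHS]card_ord -(card_imset (f := fun i => Ordinal (lt i))); last first.
  by move=> i j [] /addnI/val_inj.
apply: eq_card => i; rewrite inE; apply/idP/imsetP => [i_n|[j _ ->]] /=.
  have lt_i : (i - n < n)%N by lia.
  by exists (Ordinal lt_i) => //; apply/val_inj => /=; lia.
by have := ltn_ord j; lia.
Qed.

(** As u <= u + v, the integer square root of the code is u + v. *)
Lemma edge_code_inj u v u' v' :
  ((u + v) ^ 2 + u = (u' + v') ^ 2 + u')%N -> u = u' /\ v = v'.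
Proof.
move=> E; have : (u + v = u' + v')%N by rewrite -!mulnn in E; nia.
by move=> Es; rewrite Es in E; lia.
Qed.

(** Outside the vertices, [w] turns on exactly the switches of the pairs (u, f u). Their codes are
    below (4n)^2, which the bound on [N] makes room for. *)
Lemma edge_test_matching n N (A a b : {set 'I_N}) (f : 'I_N -> 'I_N) :
    (2 <= n)%N -> (16 * n ^ 2 <= N)%N -> A \subset vertices n N ->
    {in A, forall u, f u \in vertices n N :\: A} ->
  let w := [set c : 'I_N | [exists u in A, nat_of_ord c == (u + f u) ^ 2 + u]]%N in
  edge_test (assign w A (vertices n N) a b) =
  [forall u in A, (u \in a) == (f u \in b)].
Proof.
move=> n2 le_N /subsetP AV fAV w.
have wV c : c \in w -> c \notin vertices n N.
  rewrite !inE => /existsP[u /andP[uA /eqP ->]].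
  by have := AV u uA; rewrite inE -mulnn; nia.
apply/forallP/forall_inP => [ok u uA|eq_ab [[u v] c]] /=.
  have uV := AV u uA; have /setDP[fuV fuA] := fAV u uA.
  have lt_c : ((u + f u) ^ 2 + u < N)%N.
    by move: uV fuV le_N; rewrite !inE -!mulnn; nia.
  have := ok (u, f u, Ordinal lt_c); rewrite /= eqxx !ffunE uV fuV uA (negPf fuA).
  have cw : Ordinal lt_c \in w.
    by rewrite inE; apply/existsP; exists u; rewrite uA /=.
  by rewrite (negPf (wV _ cw)) cw.
apply/implyP => /eqP c_uv; apply/implyP; rewrite !ffunE.
(* A switch that is a vertex belongs to an edge with both ends below n; these ends are neither
   vertices nor in [w], hence both 0. *)
have [cV _|cV] := boolP (c \in vertices n N).
  have [un vn] : (u < n /\ v < n)%N.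
    by move: cV; rewrite inE c_uv -mulnn; nia.
  have small (i : 'I_N) : (i < n)%N -> (i \in vertices n N = false) * (i \in w = false).
    move=> lt_i; split; first by rewrite inE; lia.
    apply/negP; rewrite inE => /existsP[j /andP[/AV jV /eqP i_j]].
    by move: jV lt_i; rewrite inE i_j -mulnn; nia.
  by rewrite !small.
rewrite inE => /existsP[j /andP[jA /eqP c_j]].
rewrite c_uv in c_j; have [/val_inj -> /val_inj ->] := edge_code_inj c_j.
have /setDP[fjV fjA] := fAV j jA.
by rewrite AV // jA fjV (negPf fjA); apply: eq_ab.
Qed.

Lemma ex_matching (X : finType) (A B : {set X}) : #|A| = #|B| ->
  exists f : X -> X, {in A &, injective f} /\ {in A, forall x, f x \in B}.
Proof.
move=> cAB; exists (fun x => nth x (enum B) (index x (enum A))).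
have lt x : x \in A -> (index x (enum A) < size (enum B))%N.
  by move=> xA; rewrite -cardE -cAB cardE index_mem mem_enum.
split=> [x y xA yA|x xA]; last by rewrite -[_ \in B]mem_enum mem_nth ?lt.
rewrite (set_nth_default y x) ?lt // => /eqP.
rewrite nth_uniq ?lt ?enum_uniq // => /eqP/(index_inj x); apply;
  by rewrite mem_enum.
Qed.

(** With rows the subsets of [A] and columns their images under a matching, the matrix is the
    identity of order 2^(n/2). This order is at most some r with r^2 * 2^d <= size^2 * 2^n. *)
Lemma mlformula_lower_bound (K : fieldType) N (F : formula K N) n tau d t :
    mlformula F -> (forall x, ev (fpoly F) x = (edge_test x)%:R) ->
    (2 <= n)%N -> ~~ odd n -> (16 * n ^ 2 <= N)%N ->
    (d <= tau)%N -> (4 ^ t * tau <= n)%N ->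
    (n.+1 ^ 2 * fsize F ^ 2 * (2 * d) ^ (2 * t) < tau ^ t)%N ->
  (2 ^ d <= fsize F ^ 2)%N.
Proof.
move=> mlF evF n2 n_even le_N le_d le_n lt_tau.
have cV : #|vertices n N| = n by apply: card_vertices; nia.
have [||| A [AV cA unb]] := @ex_unbalanced K N F (vertices n N) tau d t; rewrite ?cV //.
  exact: ltnW.
have cA' : #|A| = #|vertices n N :\: A|.
  have := cardsID A (vertices n N); rewrite (setIidPr AV) cV cA cV.
  have := odd_double_half n; rewrite (negPf n_even) add0n => nE.
  by rewrite -[X in _ = X]nE -addnn => /addnI ->.
have [f [f_inj fA]] := ex_matching cA'.
pose w := [set c : 'I_N | [exists u in A, nat_of_ord c == (u + f u) ^ 2 + u]]%N.
have [r [rk le_r]] := ev_mx_rank w mlF le_d unb.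
rewrite cV in le_r.
suff le_rank : (2 ^ n./2 <= r)%N.
  rewrite -(leq_pmul2r (m := 2 ^ n)%N) ?expn_gt0 // (leq_trans _ le_r) //.
  rewrite mulnC leq_mul2r; apply/orP; right.
  by rewrite -[X in (2 ^ X <= _)%N]even_halfK // -muln2 expnM leq_sqr //.
rewrite -cV -cA -card_powerset.
apply: (sep_rank_id (e := fun i : 'I_#|powerset A| => enum_val i)
  (e' := fun j => f @: enum_val j) _ rk) => i j.
rewrite /ev_mx evF (edge_test_matching _ _ n2 le_N AV fA); congr (_%:R).
have /setIidPl iA : enum_val i \subset A by rewrite -powersetE enum_valP.
have jA : enum_val j \subset A by rewrite -powersetE enum_valP.
have f_in u : u \in A -> (f u \in f @: enum_val j) = (u \in enum_val j).
  move=> uA; apply/imsetP/idP => [[v vj /f_inj -> //]|uj]; last by exists u.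
  exact: (subsetP jA).
congr (nat_of_bool _); rewrite -(inj_eq enum_val_inj).
apply/forall_inP/eqP => [eq_ij|-> u uA]; last by rewrite f_in.
apply/setP => u; have [uA|uA] := boolP (u \in A).
  by rewrite -f_in //; apply/eqP/eq_ij.
rewrite -iA inE (negPf uA) andbF; apply/esym/negP => /(subsetP jA).
by rewrite (negPf uA).
Qed.

(** * A small formula for the hard function *)

(** On the cube 1 - x_c (x_u - x_v)^2 is the truth value of the implication, as the square absorbs
    the sign. Its nine leaves give the constant in the size bound. *)
Definition edge_formula (K : nzRingType) N (e : 'I_N * 'I_N * 'I_N) : formula K N :=
  let: (u, v, c) := e in
  let D := Add (Var u) (Mul (Const (- 1)) (Var v)) in
  if (nat_of_ord c == (u + v) ^ 2 + u)%N
  then Add (Const 1) (Mul (Const (- 1)) (Mul (Var c) (Mul D D)))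
  else Const 1.

Lemma ev_edge_formula (K : idomainType) N x (e : 'I_N * 'I_N * 'I_N) :
  ev (fpoly (edge_formula K e)) x = (edge_ok x e)%:R.
Proof.
case: e => [[u v] c] /=; case: eqP => _ /=; last exact: meval1.
rewrite /ev !(mevalD, mevalM, mevalC, mevalXU).
case: (x u) (x v) (x c) => [] [] [];
  by rewrite /= !(mulr0, mul0r, mulr1, mul1r, addr0, add0r, subrr, mulrNN).
Qed.

Lemma ex_edge_test_formula (K : idomainType) N : exists F : formula K N,
  (fsize F <= 9 * N ^ 3 + 1)%N /\ forall x, ev (fpoly F) x = (edge_test x)%:R.
Proof.
pose prod (s : seq ('I_N * 'I_N * 'I_N)) :=
  foldr (fun e F => Mul (edge_formula K e) F) (Const 1) s.
have size_prod s : (fsize (prod s) <= 9 * size s + 1)%N.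
  elim: s => //= -[[u v] c] s IH; rewrite mulnS -addnA leq_add //=.
  by case: ifP.
have ev_prod x s : ev (fpoly (prod s)) x = (all (edge_ok x) s)%:R.
  elim: s => [|e s IH] /=; first exact: meval1.
  by rewrite [LHS]mevalM -!/(ev _ _) IH ev_edge_formula -natrM mulnb.
exists (prod (enum {: 'I_N * 'I_N * 'I_N})); split=> [|x].
  apply: leq_trans (size_prod _) _.
  by rewrite -cardE !card_prod card_ord; lia.
rewrite ev_prod; congr (_%:R); congr nat_of_bool.
by apply/allP/forallP => H e; rewrite H // mem_enum.
Qed.

(** * Parameters and conclusion *)

(** The value is at most M * N^(size r) with M the sum of the absolute coefficients, and M < m <=
    2^m <= N^m. *)
Lemma horner_leq_exp (R : realType) (r : {poly R}) : exists c : nat,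
  forall N s : nat, (2 <= N)%N -> s%:R <= r.[N%:R] -> (s <= N ^ c)%N.
Proof.
pose M := \sum_(i < size r) `|r`_i|; pose m := Num.bound M.
have M_ge0 : 0 <= M by apply: sumr_ge0.
exists (m + size r)%N => N s N2 le_s; rewrite -(ler_nat R) (le_trans le_s) //.
have N1 : 1 <= N%:R :> R by rewrite ler1n ltnW.
apply: le_trans (_ : M * N%:R ^+ size r <= _).
  rewrite horner_coef mulr_suml ler_sum // => i _.
  apply: le_trans (ler_norm _) _; rewrite normrM ler_wpM2l // normrX normr_nat.
  by rewrite ler_weXn2l // ltnW.
rewrite natrX exprD ler_wpM2r ?exprn_ge0 //.
have /ltW le_M : M < m%:R by apply: archi_boundP.
rewrite (le_trans le_M) // -natrX ler_nat.
by rewrite (leq_trans (ltnW (ltn_expl m (isT : 1 < 2)%N))) // leq_expn2r.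
Qed.

Lemma ex_exp2_gt_linear a b : exists g, (b <= g /\ a * g + b <= 2 ^ g)%N.
Proof.
exists (2 * (2 * (a + b)))%N; split; first by lia.
set h := (2 * (a + b))%N; have lt_h : (h.+1 <= 2 ^ h)%N by apply: ltn_expl.
rewrite mul2n -addnn expnD.
by apply: leq_trans (leq_mul lt_h lt_h); rewrite /h; nia.
Qed.

(** The exponents make N = 16 n^2 and n = 4^t * tau exactly, and 2^d > (N^c)^2. *)
Lemma parameters c : exists t g : nat, let N := (2 ^ (4 + 4 * t + 16 * g))%N in
  let n := (2 ^ (2 * t + 8 * g))%N in let tau := (2 ^ (8 * g))%N in
  let d := (2 * (c * (4 + 4 * t + 16 * g))).+1 in
  [/\ (0 < t)%N, (d <= tau)%N &
    forall s, (s <= N ^ c -> n.+1 ^ 2 * s ^ 2 * (2 * d) ^ (2 * t) < tau ^ t)%N].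
Proof.
(* Once 2d <= 2^g, comparing exponents of 2 leaves 4t + 16g + 2 + 2c(4 + 4t + 16g) + 2gt < 8gt. For
   large g this needs 6t > 32c + 16. *)
pose t := (8 * c + 8)%N.
(* Here 2d = 64cg + 16c + 16ct + 2; [le_g] makes g absorb the terms free of g. *)
have [g [le_g lin_g]] := ex_exp2_gt_linear (64 * c) (16 * c + 16 * c * t + 2 + t).
exists t, g => N n tau d.
have le_2d : (2 * d <= 2 ^ g)%N by apply: leq_trans lin_g; rewrite /d; lia.
split=> [||s le_s]; first by rewrite /t addnS.
  by apply: leq_trans (_ : 2 ^ g <= _)%N; rewrite ?leq_exp2l //; lia.
apply: leq_ltn_trans (_ : (2 ^ (2 * t + 8 * g).+1) ^ 2 * (N ^ c) ^ 2 *
   (2 ^ g) ^ (2 * t) < _)%N.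
  by rewrite !leq_mul ?leq_sqr ?leq_expn2r // /n ltn_exp2l.
rewrite /N /tau -!expnM -!expnD ltn_exp2l //; clear -le_g; nia.
Qed.

Theorem corollary13 (R : realType) :
  exists f : forall n : nat, {ffun 'I_n -> bool} -> R,
    (exists q : {poly R}, forall n : nat, exists F : formula R[i] n,
        (fsize F)%:R <= q.[n%:R] /\
        agrees_on_cube (fpoly F) (fun x => (f n x)%:C)) /\
    ~ (exists r : {poly R}, forall n : nat,
        (MFS (fun x => (f n x)%:C))%:R <= r.[n%:R]).
Proof.
exists (fun n x => (edge_test x)%:R); split.
  exists (9%:R *: 'X^3 + 1) => N.
  have [F [le_F evF]] := ex_edge_test_formula R[i] N.
  exists F; split; last by move=> x; rewrite [LHS]evF rmorph_nat.
  by rewrite hornerD hornerZ hornerXn hornerC -natrX -natrM natr1 ler_nat -addn1.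
case=> r le_r; have [c le_c] := horner_leq_exp r.
have [t [g]] := parameters c.
set N := (2 ^ _)%N; set n := (2 ^ (_ + _))%N; set tau := (2 ^ _)%N; set d := _.+1.
move=> [t_gt0 le_d lt_tau].
pose f x : R[i] := ((@edge_test N x)%:R : R)%:C.
have [[p [mlp pf eqp]] _] := MFSP f.
have [[F [mlF Fp sizeF]] _] := MFS_polyP mlp.
have le_F : (fsize F <= N ^ c)%N.
  rewrite sizeF eqp; apply: le_c; last exact: le_r.
  by rewrite /N (leq_exp2l (m := 2) 1) //; lia.
(* As d > 2c log2 N, this contradicts size at most N^c. *)
suff : (2 ^ d <= fsize F ^ 2)%N.
  rewrite leqNgt => /negP; apply; rewrite (@leq_ltn_trans ((N ^ c) ^ 2)) ?leq_sqr //.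
  by rewrite /N -!expnM ltn_exp2l // /d; lia.
apply: (mlformula_lower_bound mlF _ _ _ _ le_d _ (lt_tau _ le_F)).
- by move=> x; rewrite /ev Fp pf /f rmorph_nat.
- by rewrite /n (leq_exp2l (m := 2) 1) // addn_gt0 muln_gt0 t_gt0.
- by rewrite /n oddX orbF -lt0n addn_gt0 muln_gt0 t_gt0.
- by rewrite /n /N -expnM -[16%N]/(2 ^ 4)%N -expnD leq_exp2l //; lia.
by rewrite /n /tau -[4%N]/(2 ^ 2)%N -expnM -expnD.
Qed.
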